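(* Let $n \geq 2$ be an integer and let \[ G = \Big\{2^{n-1},\ 2^{n-1} + 2^{n-2},\ \ldots,\ \sum_{i=1}^{n}2^{n-i}\Big\} = \Big\{\sum_{i=1}^{b} 2^{n-i} : 1 \le b \le n\Big\}. \] Let $l$ be a non-decreasing integer-valued sequence with $l(1) = 2^{n-1}$ and $l(k+1) - l(k) \in G$ for all $k \ge 1$. Set $D_1 = \{l(k)\}_{k=1}^{\infty}$ and \[ D_2 = D_1 \pm 2^{n-2},\quad D_3 = D_1 \pm 2^{n-2} \pm 2^{n-3},\quad \ldots,\quad D_n = D_1 \pm 2^{n-2} \pm 2^{n-3} \pm \cdots \pm 2 \pm 1 . \] Then $D_1, D_2, \ldots, D_n$ are pairwise disjoint and their union is the set of all positive integers.
   Context: For a set $S$ of real numbers and a real number $r$, $S \pm r = \{s + r : s \in S\} \cup \{s - r : s \in S\}$, and iteratively $S \pm r_1 \pm \cdots \pm r_m = (S \pm r_1 \pm \cdots \pm r_{m-1}) \pm r_m$. *)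

(* Defs.v *)
From HB Require Import structures.
From mathcomp Require Import all_boot all_order all_algebra.
From mathcomp Require Import classical_sets reals.

Set Implicit Arguments.
Unset Strict Implicit.
Unset Printing Implicit Defensive.

Import Order.TTheory GRing.Theory Num.Theory.
Local Open Scope classical_set_scope.
Local Open Scope ring_scope.

Definition pm (R : realType) (S : set R) (r : R) : set R :=
  [set s + r | s in S] `|` [set s - r | s in S].

(* S +- r_1 +- ... +- r_m, associating to the left *)
Definition pms (R : realType) (S : set R) (rs : seq R) : set R := foldl (@pm R) S rs.

(* All exponents satisfy i <= b <= n, so the natural subtraction is exact. *)
Definition G (n : nat) : set int :=
  [set \sum_(1 <= i < b.+1) 2 ^+ (n - i)%N | b in [set b : nat | (1 <= b <= n)%N]].

(* Sequences are indexed from 1: the value l 0 plays no role. *)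
Definition D1 (R : realType) (l : nat -> int) : set R :=
  [set (l k)%:~R | k in [set k : nat | (1 <= k)%N]].
Arguments D1 : clear implicits.

(* D_j = D_1 +- 2^(n-2) +- ... +- 2^(n-j) for 1 <= j <= n; the list is empty for j = 1. *)
Definition D (R : realType) (n : nat) (l : nat -> int) (j : nat) : set R :=
  pms (D1 R l) [seq 2 ^+ (n - i)%N | i <- index_iota 2 j.+1].
Arguments D : clear implicits.

(* Main.v *)
Require Import Defs.
From HB Require Import structures.
From mathcomp Require Import all_boot all_order all_algebra.
From mathcomp Require Import classical_sets reals.
From mathcomp Require Import zify ring.

Set Implicit Arguments.
Unset Strict Implicit.
Unset Printing Implicit Defensive.

Import Order.TTheory GRing.Theory Num.Theory.
Local Open Scope classical_set_scope.
Local Open Scope ring_scope.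

(** Put c = 2^(n-1). The signed sums of 2^(n-2), ..., 2^(n-j) are the numbers
    w - c with w an odd multiple of 2^(n-j) and 0 < w < 2^n, so D_j consists of
    the l(k) - c + w with 0 < w < 2^n of 2-adic valuation exactly n-j. The gaps
    2^n - 2^(n-b) are smaller than 2^n, so these windows cover the positive
    integers; they are at least 2^(n-1), so only consecutive windows overlap.
    If w = w' + 2^n - 2^(n-b) with w < 2^n, then w' < 2^(n-b), hence adding the
    gap does not change the 2-adic valuation of w'. *)

Lemma logn_addl p m n : (0 < n)%N -> (logn p n < logn p m)%N ->
  logn p (m + n) = logn p n.
Proof.
move=> n0 lt_nm.
(* [logn p] is constantly 0 when [p] is not prime, so the strict inequality forces primality. *)
have pp : prime p by move: lt_nm; rewrite /logn; case: (prime p).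
have mn0 : (0 < m + n)%N by rewrite addn_gt0 n0 orbT.
apply/eqP; rewrite eqn_leq; apply/andP; split.
  rewrite leqNgt; apply/negP => lt_s.
  have : (p ^ (logn p n).+1 %| m + n)%N by rewrite pfactor_dvdn.
  rewrite dvdn_addr; first by rewrite pfactor_dvdn // ltnn.
  by apply: dvdn_trans (pfactor_dvdnn p m); apply: dvdn_exp2l.
rewrite -pfactor_dvdn // dvdn_add ?pfactor_dvdnn //.
by apply: dvdn_trans (pfactor_dvdnn p m); apply/dvdn_exp2l/ltnW.
Qed.

Lemma logn_lt_exp p n m : prime p -> (0 < n)%N -> (n < p ^ m)%N ->
  (logn p n < m)%N.
Proof.
move=> pp n0 lt_n; rewrite -(ltn_exp2l _ _ (prime_gt1 pp)).
by apply: leq_ltn_trans lt_n; apply/dvdn_leq/pfactor_dvdnn.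
Qed.

Lemma logn2_odd_mul e a : logn 2 (2 ^ e * a.*2.+1) = e.
Proof.
rewrite lognM ?expn_gt0 // pfactorK // logn_coprime ?addn0 //.
by rewrite coprime2n /= odd_double.
Qed.

Lemma PoszX m e : (m ^ e)%N%:Z = m%:Z ^+ e.
Proof. by rewrite -!natz natrX. Qed.

Lemma sum_exp2 n b : (b <= n)%N ->
  \sum_(1 <= i < b.+1) 2 ^+ (n - i)%N = 2 ^+ n - 2 ^+ (n - b)%N :> int.
Proof.
elim: b => [|b IHb] le_bn; first by rewrite big_geq // subn0 subrr.
rewrite big_nat_recr //= IHb 1?ltnW //.
by rewrite (_ : (n - b)%N = (n - b.+1).+1) ?exprS; [ring | lia].
Qed.

Lemma DS (R : realType) n l j :
  D R n l j.+2 = pm (D R n l j.+1) (2 ^+ (n - j.+2)%N).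
Proof.
rewrite /D /pms /index_iota !subSS !subn0.
have -> : iota 2 j.+1 = iota 2 j ++ [:: j.+2].
  by rewrite -[X in iota 2 X]addn1 iotaD.
by rewrite map_cat foldl_cat.
Qed.

(** With q = 2^(n-j-2), one more step turns 2q(2a+1) into q(4a+3) or q(4a+1), so the index [a]
    becomes 2a+1 for a plus and 2a for a minus: the binary digits of [a] record the signs. *)
Lemma D_odd_multiple (R : realType) n (l : nat -> int) j x : (j < n)%N ->
  D R n l j.+1 x <-> exists k a, [/\ (1 <= k)%N, (a < 2 ^ j)%N &
    x = (l k - 2 ^+ (n - 1) + (2 ^ (n - j.+1) * a.*2.+1)%N%:Z)%:~R].
Proof.
elim: j x => [|j IHj] x lt_jn.
  have E k : l k = l k - 2 ^+ (n - 1) + (2 ^ (n - 1) * 0.*2.+1)%N%:Z.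
    by rewrite muln1 PoszX subrK.
  split=> [[k k1 <-]|[k [a [k1]]]]; first by exists k, 0%N; split=> //; rewrite -E.
  by rewrite expn0 ltnS leqn0 => /eqP-> ->; rewrite -E; exists k.
have P : (2 ^ (n - j.+1) = 2 * 2 ^ (n - j.+2))%N.
  by rewrite -expnS; congr (_ ^ _)%N; lia.
have pow : 2 ^+ (n - j.+2) = (2 ^ (n - j.+2))%N%:Z%:~R :> R.
  by rewrite -pmulrn natrX.
rewrite DS; split.
  case=> -[y /(IHj _ (ltnW lt_jn)) [k [a [k1 lt_a ->]]] <-].
    exists k, a.*2.+1; split=> //; first by rewrite expnS; lia.
    rewrite pow -intrD P; congr (_%:~R); lia.
  exists k, a.*2; split=> //; first by rewrite expnS; lia.
  rewrite pow -intrB P; congr (_%:~R); lia.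
(* Conversely, the parity of [a] gives the last sign and its half is the index one level below. *)
case=> k [a [k1 + ->]]; rewrite -[a]odd_double_half.
move: (odd a) (a./2) => s {}a lt_a.
have Dy : D R n l j.+1
    (l k - 2 ^+ (n - 1) + (2 ^ (n - j.+1) * a.*2.+1)%N%:Z)%:~R.
  apply/(IHj _ (ltnW lt_jn)); exists k, a; split=> //.
  by move: lt_a; rewrite expnS; lia.
case: s {lt_a} => /=; [left|right]; eexists; try exact: Dy;
  rewrite pow -?intrD -?intrB P; congr (_%:~R); lia.
Qed.

(** The odd part of [w] is 2a+1, and the bound on [a] amounts to w < 2^n. *)
Lemma D_logn (R : realType) n (l : nat -> int) j x : (1 <= j <= n)%N ->
  D R n l j x <-> exists k w, [/\ (1 <= k)%N, (0 < w < 2 ^ n)%N,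
    logn 2 w = (n - j)%N & x = (l k - 2 ^+ (n - 1) + w%:Z)%:~R].
Proof.
case: j => [//|j] /= lt_jn; rewrite D_odd_multiple //.
have P : (2 ^ n = 2 ^ (n - j.+1) * (2 * 2 ^ j))%N.
  by rewrite -expnS -expnD subnK.
split=> [[k [a [k1 lt_a ->]]]|[k [w [k1 /andP[w0 lt_w] logw ->]]]].
  exists k, (2 ^ (n - j.+1) * a.*2.+1)%N; split=> //.
    by rewrite muln_gt0 expn_gt0 P ltn_pmul2l ?expn_gt0 //=; lia.
  by rewrite logn2_odd_mul.
have [m co_m Ew] := pfactor_coprime (isT : prime 2) w0.
have odd_m : odd m by rewrite -coprime2n.
have Em : m = m./2.*2.+1 by rewrite -[LHS]odd_double_half odd_m.
rewrite logw mulnC in Ew.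
exists k, m./2; split=> //; last by rewrite -Em -Ew.
by move: lt_w; rewrite Ew P ltn_pmul2l ?expn_gt0 //; lia.
Qed.

Section Windows.

Variables (n : nat) (l : nat -> int).
Hypothesis l_nondecreasing :
  forall j k : nat, (1 <= j)%N -> (j <= k)%N -> l j <= l k.
Hypothesis l_gap : forall k : nat, (1 <= k)%N -> G n (l k.+1 - l k).

Lemma gapP k : (1 <= k)%N -> exists2 b, (1 <= b <= n)%N &
  l k.+1 = l k + (2 ^ n)%N%:Z - (2 ^ (n - b))%N%:Z.
Proof.
move=> /l_gap [b /= /andP[b1 le_bn]]; rewrite sum_exp2 // => E.
exists b; first by rewrite b1.
by rewrite !PoszX -addrA E addrC subrK.
Qed.

Lemma gap_ge k : (1 <= k)%N -> l k + (2 ^ (n - 1))%N%:Z <= l k.+1.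
Proof.
move=> /gapP [b /andP[b1 le_bn] ->].
have le_e : (2 ^ (n - b) <= 2 ^ (n - 1))%N by rewrite leq_exp2l //; lia.
have : (2 ^ n = 2 * 2 ^ (n - 1))%N by rewrite -expnS; congr (_ ^ _)%N; lia.
lia.
Qed.

Lemma overlap_logn k k' w w' : (1 <= k)%N -> (k <= k')%N ->
  (0 < w < 2 ^ n)%N -> (0 < w' < 2 ^ n)%N -> l k + w%:Z = l k' + w'%:Z ->
  logn 2 w = logn 2 w'.
Proof.
move=> k1 le_k /andP[w0 ltw] /andP[w'0 ltw'].
have [->|lt_k] := eqVneq k k'; first by move/addrI => [->].
have [->|ne_k] := eqVneq k' k.+1; last first.
  (* The gap is opened only to get 1 <= n. Two gaps already add up to at least 2^n, which exceeds
     any difference w - w'. *)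
  have [b /andP[b1 le_bn] _] := gapP k1.
  have le_l : l k.+2 <= l k' by apply: l_nondecreasing; lia.
  have := gap_ge k1; have := gap_ge (leqW k1).
  have : (2 ^ n = 2 * 2 ^ (n - 1))%N by rewrite -expnS; congr (_ ^ _)%N; lia.
  lia.
have [b /andP[b1 le_bn] ->] := gapP k1 => E.
have lt_e : (2 ^ (n - b) < 2 ^ n)%N by rewrite ltn_exp2l //; lia.
have -> : w = (2 ^ n - 2 ^ (n - b) + w')%N by lia.
apply: logn_addl => //; apply: leq_trans (_ : n - b <= _)%N.
  by apply: logn_lt_exp => //; lia.
by rewrite -pfactor_dvdn ?subn_gt0 // dvdn_sub // dvdn_exp2l // leq_subr.
Qed.

Lemma windows_cover m : l 1%N < m -> exists k w,
  [/\ (1 <= k)%N, (0 < w < 2 ^ n)%N & m = l k + w%:Z].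
Proof.
move=> lt_m.
have grow k : l 1%N + k%:Z <= l k.+1.
  elim: k => [|k IHk]; first by rewrite addr0.
  have := gap_ge (isT : (1 <= k.+1)%N).
  have : (0 < 2 ^ (n - 1))%N by rewrite expn_gt0.
  lia.
have ex_k : exists k, m <= l k.+1.
  by exists `|m - l 1%N|%N; have := grow `|m - l 1%N|%N; lia.
(* The least index is nonzero because [l 1 < m]; minimality then puts [m] above [l k.+1] and at most
   [l k.+2], an interval shorter than 2^n. *)
have [[|k] le_mk min_k] := ex_minnP ex_k; first by lia.
have lt_km : l k.+1 < m.
  by rewrite ltNge; apply/negP => /min_k; rewrite ltnn.
have [b /andP[b1 le_bn] E] := gapP (isT : (1 <= k.+1)%N).
have e0 : (0 < 2 ^ (n - b))%N by rewrite expn_gt0.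
exists k.+1, `|m - l k.+1|%N; split=> //; lia.
Qed.

End Windows.

Theorem theorem2p2 (R : realType) (n : nat) (l : nat -> int)
  (hn : (2 <= n)%N)
  (l_nondecreasing : forall j k : nat, (1 <= j)%N -> (j <= k)%N -> l j <= l k)
  (l1 : l 1%N = 2 ^+ (n - 1)%N)
  (l_gap : forall k : nat, (1 <= k)%N -> G n (l k.+1 - l k)) :
  (forall i j : nat, (1 <= i <= n)%N -> (1 <= j <= n)%N -> i <> j ->
     D R n l i `&` D R n l j = set0) /\
  \bigcup_(i in [set i : nat | (1 <= i <= n)%N]) D R n l i =
    [set m%:~R | m in [set m : int | 0 < m]].
Proof.
split=> [i j hi hj ne_ij|].
  apply/seteqP; split=> // x [].
  move=> /(D_logn _ _ hi) [k [w [k1 hw logw ->]]].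
  move=> /(D_logn _ _ hj) [k' [w' [k'1 hw' logw' /intr_inj E]]].
  have {}E : l k + w%:Z = l k' + w'%:Z by lia.
  suff : logn 2 w = logn 2 w' by move: hi hj; rewrite logw logw'; lia.
  case: (leqP k k') => [le_k|/ltnW le_k].
    exact: (overlap_logn l_nondecreasing l_gap) E.
  by apply/esym/(overlap_logn l_nondecreasing l_gap k'1 le_k hw' hw).
apply/seteqP; split=> x.
  case=> i /= hi /(D_logn _ _ hi) [k [w [k1 /andP[w0 _] _ ->]]].
  exists (l k - 2 ^+ (n - 1) + w%:Z) => //=.
  by have := l_nondecreasing 1%N k isT k1; lia.
case=> m /= m0 <-.
(* The shift by 2^(n-1) = l(1) undoes the centring of the windows and turns 0 < m into the premise
   of [windows_cover]. *)
have [|k [w [k1 hw E]]] := windows_cover l_gap (m := m + 2 ^+ (n - 1)).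
  by rewrite l1; lia.
have lt_log : (logn 2 w < n)%N by case/andP: hw => w0 ltw; apply: logn_lt_exp.
(* The valuation of the offset [w] selects which set contains [m]. *)
have hj : (1 <= n - logn 2 w <= n)%N by lia.
exists (n - logn 2 w)%N => //.
apply/(D_logn _ _ hj); exists k, w; split=> //; first by lia.
by congr (_%:~R); lia.
Qed.
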